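(* Let $K\subseteq\mathbb R$ be compact. If $C^\infty(K)$ has a dominating norm, then there exist $n\in\mathbb N$ and $s\in\mathbb N$ such that for all $\varepsilon\in(0,1/2)$ and all $z\in K$: if $(z-\varepsilon^s,z+\varepsilon^s)$ contains at least $n+2$ points of $K$, then $\bigl(K\cap(z-\varepsilon,z+\varepsilon)\bigr)\setminus(z-\varepsilon^s,z+\varepsilon^s)\neq\emptyset$.
   Context: For compact $K\subseteq\mathbb R$ let $C^\infty(K)=\{F|_K: F\in C^\infty(\mathbb R)\}$, endowed with the quotient topology of the Fréchet space $C^\infty(\mathbb R)$ under the restriction map $F\mapsto F|_K$. This topology is given by the norms $|||f|||_n=\inf\{\|F\|_n: F\in C^\infty(\mathbb R),\ F|_K=f\}$, where $\|F\|_n=\sup\{|F^{(j)}(x)|:x\in\mathbb R,\ 0\le j\le n\}\in[0,\infty]$. A Fréchet space $X$ with an increasing fundamental sequence of seminorms $(\|\cdot\|_n)_n$ has a dominating norm (satisfies $(\mathrm{DN})$) if there is $n$ such that for every $m\ge n$ there are $k\ge m$ and $c>0$ with $\|x\|_m^2\le c\,\|x\|_k\,\|x\|_n$ for all $x\in X$; this does not depend on the choice of the fundamental sequence of seminorms. *)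

(* Defs.v *)
From mathcomp Require Import all_boot all_order all_algebra.
From mathcomp Require Import all_classical all_reals all_analysis.

Set Implicit Arguments.
Unset Strict Implicit.
Unset Printing Implicit Defensive.

Import Order.TTheory GRing.Theory Num.Theory.
Import numFieldNormedType.Exports.

Local Open Scope classical_set_scope.
Local Open Scope ring_scope.

Definition smooth (R : realType) : set (R -> R) :=
  [set F | forall (j : nat) (x : R), derivable (derive1n j F) x 1].

(* No finiteness of the supremum is required: F need not have bounded
   derivatives on R. *)
Definition norm_Cn (R : realType) (n : nat) (F : R -> R) : \bar R :=
  ereal_sup [set `|derive1n j F x|%:E | j in [set j | (j <= n)%N] & x in [set: R]].

Definition smooth_on (R : realType) (K : set R) : set (K -> R) :=
  [set sigL K F | F in @smooth R].
Arguments smooth_on {R} K _.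

(* The quotient norms |||f|||_n.  The set of smooth extensions of f is never
   empty for f in smooth_on K, and for compact K a cutoff gives one of finite
   norm, so on smooth_on K these are finite, increasing in n, and they generate
   the quotient topology. *)
Definition quot_norm (R : realType) (K : set R) (n : nat) (f : K -> R) :
    \bar R :=
  ereal_inf [set norm_Cn n F | F in [set F | smooth F /\ sigL K F = f]].

(* (DN) for a space X whose topology is given by the increasing fundamental
   sequence p of seminorms. *)
Definition dominating_norm (R : realType) (X : Type) (p : nat -> X -> \bar R) :
    Prop :=
  exists n : nat, forall m : nat, (n <= m)%N ->
    exists (k : nat) (c : R), [/\ (m <= k)%N, 0 < c &
      forall x : X, (p m x ^+ 2 <= c%:E * p k x * p n x)%E].

Definition Cinfty_has_DN (R : realType) (K : set R) : Prop :=
  dominating_norm (fun n (f : smooth_on K) => quot_norm n (\val f)).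

(* Main.v *)
Require Import Defs.
From mathcomp Require Import all_boot all_order all_algebra.
From mathcomp Require Import all_classical all_reals all_analysis.
From mathcomp Require Import ring lra.
Import Order.TTheory GRing.Theory Num.Theory.
Import numFieldNormedType.Exports.
Local Open Scope classical_set_scope.
Local Open Scope ring_scope.

(* Apply (DN), with dominating norm n and m = n + 1, to the function f on K
   that equals (x - z)^(n+1) on (z - e^s, z + e^s) and 0 elsewhere, assuming
   that K has no point in (z - e, z + e) outside (z - e^s, z + e^s).  By the
   iterated Rolle theorem at n + 2 points of K, every extension of f has an
   (n+1)-st derivative equal to (n+1)! somewhere, so |||f|||_(n+1) >= 1.
   Cutting (x - z)^(n+1) off at scale e gives |||f|||_k <= M e^-k, and cutting
   it off at scale 2 e^s gives |||f|||_n <= 2 M e^s.  Hence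
   1 <= 2 c M^2 e^(s - k), which fails for all e < 1/2 once s is large. *)

(** * Finite-order differentiability and its closure properties *)

(* Unlike smooth, this lets one exhibit the derivative, so closure properties
   follow by induction on n without computing iterated derivatives. *)
Fixpoint times_derivable (R : realType) (n : nat) (F : R -> R) : Prop :=
  if n is m.+1 then
    exists2 dF : R -> R,
      forall x : R, is_derive x 1 F (dF x) & times_derivable R m dF
  else True.
Arguments times_derivable {R} n F.

Lemma times_derivable_eq {R : realType} n (F G : R -> R) :
  F =1 G -> times_derivable n F -> times_derivable n G.
Proof. by move=> /funext ->. Qed.

Lemma smoothP {R : realType} (F : R -> R) :
  smooth F <-> forall n, times_derivable n F.
Proof.
split=> [sF n|].
  elim: n F sF => //= n IHn F sF; exists (derive1 F).
    by move=> x; rewrite derive1E; apply: derivableP; exact: (sF 0%N).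
  by apply: IHn => j x; rewrite -derive1Sn; exact: sF.
move=> tdF j; elim: j F tdF => [|j IHj] F tdF x.
  by have [dF FdF _] := tdF 1%N; exact: ex_derive.
(* The witness [dF] may vary with [n]; uniqueness of derivatives identifies it with [derive1 F]. *)
rewrite derive1Sn; apply: IHj => n; have [dF FdF ndF] := tdF n.+1.
apply: times_derivable_eq ndF => y.
by rewrite derive1E derive_val.
Qed.

Lemma times_derivableW {R : realType} n (F : R -> R) :
  times_derivable n.+1 F -> times_derivable n F.
Proof.
elim: n F => //= n IHn F [dF FdF ndF]; exists dF => //; exact: IHn.
Qed.

Lemma times_derivable_cst {R : realType} n (c : R) :
  times_derivable n (fun=> c).
Proof.
by elim: n c => //= n IHn c; exists (fun=> 0) => // x; exact: is_derive_cst.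
Qed.

Lemma times_derivableD {R : realType} n (F G : R -> R) :
  times_derivable n F -> times_derivable n G ->
  times_derivable n (fun x => F x + G x).
Proof.
elim: n F G => //= n IHn F G [dF FdF ndF] [dG GdG ndG].
exists (fun x => dF x + dG x); last exact: IHn.
by move=> x; apply: is_deriveD.
Qed.

Lemma times_derivableM {R : realType} n (F G : R -> R) :
  times_derivable n F -> times_derivable n G ->
  times_derivable n (fun x => F x * G x).
Proof.
elim: n F G => // n IHn F G nF nG.
have [dF FdF ndF] := nF; have [dG GdG ndG] := nG.
exists (fun x => F x * dG x + G x * dF x).
  by move=> x; apply: is_deriveM.
by apply: times_derivableD; apply: IHn => //; exact: times_derivableW.
Qed.

Lemma times_derivableV {R : realType} n (F : R -> R) :
  (forall x, F x != 0) -> times_derivable n F ->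
  times_derivable n (fun x => (F x)^-1).
Proof.
move=> F0; elim: n => // n IHn nF; have [dF FdF ndF] := nF.
(* -F'/F^2 is written with two separate inverses, so that the induction hypothesis and the product
   rule apply. *)
exists (fun x => (-1 * ((F x)^-1 * (F x)^-1)) * dF x).
  move=> x; apply: (is_derive_eq (is_deriveV (F0 x) (FdF x))).
  by rewrite /GRing.scale/= mulN1r expr2 invfM.
have /IHn nV := times_derivableW _ _ nF.
apply: times_derivableM => //; apply: times_derivableM.
  exact: times_derivable_cst.
exact: times_derivableM.
Qed.

Lemma is_derive_affine {R : realType} (a b x : R) :
  is_derive x 1 (fun x : R => a * x + b) a.
Proof.
apply: (is_derive_eq (is_deriveD (is_deriveM (is_derive_cst a x 1)
  (is_derive_id x 1)) (is_derive_cst b x 1))).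
by rewrite /GRing.scale/= mulr1 mulr0 !addr0.
Qed.

Lemma times_derivable_affine {R : realType} n (F : R -> R) (a b : R) :
  times_derivable n F -> times_derivable n (fun x => F (a * x + b)).
Proof.
elim: n F => //= n IHn F [dF FdF ndF].
exists (fun x => dF (a * x + b) * a); last first.
  by apply: times_derivableM; [exact: IHn|exact: times_derivable_cst].
move=> x; apply: (is_derive1_comp (g := fun x => a * x + b)) => //.
exact: is_derive_affine.
Qed.

Lemma times_derivableX {R : realType} n m :
  times_derivable n (fun x : R => x ^+ m).
Proof.
elim: m => [|m IHm]; first exact: times_derivable_cst.
apply: (@times_derivable_eq _ _ (fun x => x * x ^+ m)).
  by move=> x; rewrite exprS.
apply: times_derivableM => //; case: n {IHm} => // n; exists (fun=> 1).
  by move=> x; exact: is_derive_id.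
exact: times_derivable_cst.
Qed.

(** * Smooth functions flat at the origin *)

(** Termwise, y^i <= i! e^y by the exponential series. At y = 1/x this lets e^(-1/x) absorb any
    power of 1/x. *)
Lemma horner_le_expR {R : realType} (p : {poly R}) :
  exists2 C, 0 <= C & forall y, 0 <= y -> `|p.[y]| <= C * expR y.
Proof.
exists (\sum_(i < size p) `|p`_i| * i`!%:R); first exact: sumr_ge0.
move=> y y0; rewrite horner_coef mulr_suml.
apply: (le_trans (ler_norm_sum _ _ _)); apply: ler_sum => i _.
rewrite normrM -mulrA ler_wpM2l// normrX ger0_norm//.
case: (nat_of_ord i) => [|m].
  by rewrite fact0 expr0 mul1r (le_trans _ (expR_ge1Dx y))// lerDl.
rewrite -ler_pdivrMl ?ltr0n ?fact_gt0// mulrC.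
by apply: le_trans (expR_ge1Dxn m y0); rewrite lerDr.
Qed.

(** The bound forces F(0) = 0 and |F(x)/x| <= C |x|, so the difference quotient tends to 0. *)
Lemma is_derive0_quadratic {R : realType} (F : R -> R) (C : R) :
  (forall x, `|F x| <= C * x ^+ 2) -> is_derive (0 : R) 1 F 0.
Proof.
move=> FC; have F0 : F 0 = 0.
  apply/normr0_eq0/le_anti.
  by rewrite normr_ge0 (le_trans (FC 0))// expr0n mulr0.
(* Since 0^-1 = 0, the slope F(x)/x already has the required value 0 at 0. *)
apply/is_derive1_caratheodory; exists (fun x => F x / x); split.
- move=> x; rewrite F0 !subr0.
  have [->|x0] := eqVneq x 0; last by rewrite divfK.
  by rewrite F0 mulr0.
- suff : F x / x @[x --> (0 : R)] --> (0 : R).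
    by rewrite /prop_for /continuous_at invr0 mulr0.
  apply/cvgr0Pnorm_le => e e0.
  have C0 : 0 <= C by have := FC 1; rewrite expr1n mulr1; exact: le_trans.
  have Fx x : `|F x / x| <= C * `|x|.
    have [->|x0] := eqVneq x 0; first by rewrite invr0 mulr0 normr0 mulr0.
    rewrite normrM normfV ler_pdivrMr ?normr_gt0// -mulrA -expr2 -normrX.
    by rewrite [X in _ <= _ * X]ger0_norm ?sqr_ge0.
  near=> x; apply: (le_trans (Fx x)).
  apply: (le_trans (y := (C + 1) * `|x|)).
    by rewrite ler_wpM2r// lerDl.
  rewrite -ler_pdivlMl ?ltr_wpDl//; near: x.
  exists ((C + 1)^-1 * e) => /=; first by rewrite mulr_gt0 ?invr_gt0 ?ltr_wpDl.
  by move=> x /=; rewrite sub0r normrN => /ltW.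
- by rewrite invr0 mulr0.
Unshelve. all: by end_near. Qed.

(* p(1/x) e^(-1/x), extended by 0: this family is closed under derivation. *)
Definition flat {R : realType} (p : {poly R}) (x : R) : R :=
  if 0 < x then p.[x^-1] * expR (- x^-1) else 0.

(** For x > 0 the product and chain rules give x^-2 (p - p')(1/x) e^(-1/x), whence the polynomial
    X^2 (p - p'); at 0 a quadratic bound is used. *)
Lemma is_derive_flat {R : realType} (p : {poly R}) (x : R) :
  is_derive x 1 (flat p) (flat ('X^2 * (p - p^`())) x).
Proof.
have [x0|x0|->] := ltgtP x 0; rewrite /flat ?ltxx.
- rewrite ltNge (ltW x0)/=; apply: (near_eq_is_derive (f := cst 0)).
  near=> y; rewrite ifF//; apply/negbTE; rewrite -leNgt; near: y.
  exact: lt_le_nbhsl.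
- rewrite x0.
  apply: (near_eq_is_derive (f := fun x : R => p.[x^-1] * expR (- x^-1))).
    near=> y; rewrite ifT// -oppr_lt0; near: y.
    by apply: Nlt_nbhsl; rewrite oppr_lt0.
  have dV : is_derive x 1 (fun y : R => y^-1) (- x ^- 2).
    apply: (is_derive_eq (is_deriveV (f := id) _ (is_derive_id x 1))).
      by rewrite gt_eqF.
    by rewrite /GRing.scale/= mulr1.
  have dp : is_derive x 1 (fun y => p.[y^-1]) (p^`().[x^-1] * - x ^- 2).
    exact: is_derive1_comp (is_derive_poly p x^-1) dV.
  have de : is_derive x 1 (fun y => expR (- y^-1)) (expR (- x^-1) * x ^- 2).
    have := is_derive1_comp (g := fun y => - y^-1)
      (is_derive_expR (- x^-1)) (is_deriveN dV).
    by rewrite opprK.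
  apply: (is_derive_eq (is_deriveM dp de)).
  by rewrite !hornerE/= /GRing.scale/= exprVn; ring.
(* Bounding X^2 p rather than p leaves a spare factor y^2: |p(1/y)| e^(-1/y) <= C y^2 for y > 0. *)
have [C C0 HC] := horner_le_expR ('X^2 * p).
apply: (is_derive0_quadratic _ C) => y.
case: ifPn => y0; last by rewrite normr0 mulr_ge0// sqr_ge0.
have yV0 : 0 <= y^-1 by rewrite invr_ge0 ltW.
have := HC _ yV0; rewrite hornerM hornerXn normrM normrX normfV (gtr0_norm y0).
move=> HCy; rewrite normrM (gtr0_norm (expR_gt0 _)) expRN.
rewrite ler_pdivrMr ?expR_gt0// mulrAC -ler_pdivrMr ?exprn_gt0//.
by rewrite mulrC -exprVn.
Unshelve. all: by end_near. Qed.

Lemma times_derivable_flat {R : realType} n (p : {poly R}) :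
  times_derivable n (flat p).
Proof.
elim: n p => //= n IHn p; exists (flat ('X^2 * (p - p^`()))) => // x.
exact: is_derive_flat.
Qed.

(** * A smooth step and a bump function *)

(** The standard transition function built from e^(-1/x), equal to 0 for x <= 0 and to 1 for x >=
    1. *)
Definition smooth_step {R : realType} (x : R) : R :=
  flat 1 x / (flat 1 x + flat 1 (1 - x)).

Lemma flat1_gt0 {R : realType} (x : R) : 0 < x -> 0 < flat 1 x.
Proof. by move=> x0; rewrite /flat x0 hornerC mul1r expR_gt0. Qed.

Lemma flat_le0 {R : realType} (p : {poly R}) (x : R) : x <= 0 -> flat p x = 0.
Proof. by move=> x0; rewrite /flat ltNge x0. Qed.

Lemma flat1_ge0 {R : realType} (x : R) : 0 <= flat 1 x.
Proof. by have [/flat_le0 ->//|/flat1_gt0/ltW] := leP x 0. Qed.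

Lemma times_derivable_step {R : realType} n :
  times_derivable n (@smooth_step R).
Proof.
apply: times_derivableM; first exact: times_derivable_flat.
apply: times_derivableV => [x|].
  (* At least one of x and 1 - x is positive, so the denominator never vanishes. *)
  rewrite gt_eqF//; have [x0|x0] := leP x 0.
    by rewrite ltr_wpDl ?flat1_ge0// flat1_gt0// subr_gt0 (le_lt_trans x0).
  by rewrite ltr_pwDl ?flat1_ge0// flat1_gt0.
apply: times_derivableD; first exact: times_derivable_flat.
apply: (@times_derivable_eq _ _ (fun x => flat 1 (-1 * x + 1))).
  by move=> x; rewrite mulN1r addrC.
exact/times_derivable_affine/times_derivable_flat.
Qed.

Lemma smooth_step_le0 {R : realType} (x : R) : x <= 0 -> smooth_step x = 0.
Proof. by move=> x0; rewrite /smooth_step flat_le0// mul0r. Qed.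

Lemma smooth_step_ge1 {R : realType} (x : R) : 1 <= x -> smooth_step x = 1.
Proof.
move=> x1; rewrite /smooth_step (flat_le0 _ (1 - x)) ?subr_le0// addr0 divff//.
by rewrite gt_eqF// flat1_gt0// (lt_le_trans _ x1).
Qed.

(** The first factor is 1 up to x = 1/2 and 0 from x = 1 on; the second is its mirror image. *)
Definition smooth_bump {R : realType} (x : R) : R :=
  smooth_step (2 - 2 * x) * smooth_step (2 + 2 * x).

Lemma times_derivable_bump {R : realType} n :
  times_derivable n (@smooth_bump R).
Proof.
apply: times_derivableM; [
  apply: (@times_derivable_eq _ _ (fun x => smooth_step (-2 * x + 2))) |
  apply: (@times_derivable_eq _ _ (fun x => smooth_step (2 * x + 2))) ];
  try exact/times_derivable_affine/times_derivable_step.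
  by move=> x; rewrite mulNr addrC.
by move=> x; rewrite addrC.
Qed.

Lemma smooth_bump_le {R : realType} (x : R) :
  `|x| <= 1 / 2 -> smooth_bump x = 1.
Proof.
rewrite ler_norml => /andP[x1 x2].
by rewrite /smooth_bump !smooth_step_ge1 ?mulr1//; lra.
Qed.

Lemma smooth_bump_ge {R : realType} (x : R) : 1 <= `|x| -> smooth_bump x = 0.
Proof.
rewrite ler_normr /smooth_bump => /orP[x1|x1].
  by rewrite smooth_step_le0 ?mul0r//; lra.
by rewrite [X in _ * X]smooth_step_le0 ?mulr0//; lra.
Qed.

(** * Iterated derivatives: bounds and explicit formulas *)

(** The set |x| > a is open, so near each of its points the function being differentiated is
    constantly 0. *)
Lemma derive1n_eq0_outside {R : realType} (g : R -> R) (a : R) j :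
  (forall x, a < `|x| -> g x = 0) -> forall x, a < `|x| -> derive1n j g x = 0.
Proof.
move=> g0; elim: j => [//|j IHj] x ax; rewrite derive1nS derive1E.
rewrite (near_eq_derive (g := cst 0)) ?derive_cst//.
near=> y; apply: IHj; near: y.
apply: (cvgr_gt `|x|) ax; exact: norm_continuous.
Unshelve. all: by end_near. Qed.

(** Each derivative is continuous, hence bounded on [-a, a], and it vanishes outside. *)
Lemma smooth_derive1n_bounded {R : realType} (g : R -> R) (a : R) k :
  0 <= a -> smooth g -> (forall x, a < `|x| -> g x = 0) ->
  exists2 M, 0 <= M & forall j x, (j <= k)%N -> `|derive1n j g x| <= M.
Proof.
move=> a0 sg g0.
have bound j : exists2 M, 0 <= M & forall x, `|derive1n j g x| <= M.
  have cg : {within `[-a, a], continuous (fun x => `|derive1n j g x|)}.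
    apply: continuous_subspaceT => x; apply: continuous_comp.
      exact/differentiable_continuous/derivable1_diffP/sg.
    exact: norm_continuous.
  have [|c _ cmax] := EVT_max _ cg.
    by rewrite lerNl (le_trans _ a0)// oppr_le0.
  exists `|derive1n j g c| => // x; have [ax|xa] := ltP a `|x|.
    by rewrite (derive1n_eq0_outside g a) ?normr0.
  by apply: cmax; rewrite in_itv/= -ler_norml.
elim: k => [|k [M M0 HM]].
  by have [M M0 HM] := bound 0%N; exists M => // j x; rewrite leqn0 => /eqP ->.
have [N N0 HN] := bound k.+1; exists (M + N); first exact: addr_ge0.
move=> j x; rewrite leq_eqVlt => /predU1P[->|jk].
  by rewrite (le_trans (HN x))// lerDr.
by rewrite (le_trans (HM j x _))// lerDl.
Qed.

Lemma derive1n_affine {R : realType} (g : R -> R) (c a b : R) j : smooth g ->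
  derive1n j (fun x => c * g (a * x + b)) =
  fun x => c * a ^+ j * derive1n j g (a * x + b).
Proof.
move=> sg; elim: j => [|j IHj]; first by rewrite expr0 mulr1.
rewrite derive1nS IHj; apply/funext => x; rewrite derive1E derive1nS.
have dg := is_derive1_comp (f := derive1n j g) (g := fun x => a * x + b)
  (derivableP (sg j (a * x + b))) (is_derive_affine a b x).
have dcg := is_deriveM (is_derive_cst (c * a ^+ j) x 1) dg.
rewrite (@derive_val _ _ _ _ _ _ _ dcg) derive1E /GRing.scale/= mulr0 addr0.
rewrite exprSr; ring.
Qed.

Lemma derive1nXsubC {R : realType} (z : R) m j :
  derive1n j (fun x => (x - z) ^+ m) =
  fun x => (m ^_ j)%:R * (x - z) ^+ (m - j).
Proof.
elim: j => [|j IHj]; first by apply/funext => x; rewrite ffactn0 mul1r subn0.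
rewrite derive1nS IHj; apply/funext => x; rewrite derive1E.
have dXz : is_derive x 1 (fun x => x - z) 1.
  apply: (is_derive_eq (is_deriveB (is_derive_id x 1) (is_derive_cst z x 1))).
  by rewrite subr0.
have dX : is_derive x 1 (fun x => (x - z) ^+ (m - j))
    ((m - j)%:R * (x - z) ^+ (m - j).-1).
  have := is_deriveX (m - j) dXz; rewrite /GRing.scale/= mulr1.
  by congr is_derive; apply/funext => y; rewrite exprfctE.
have dcX := is_deriveM (is_derive_cst ((m ^_ j)%:R : R) x 1) dX.
rewrite (@derive_val _ _ _ _ _ _ _ dcX) /GRing.scale/= mulr0 addr0.
by rewrite ffactnSr natrM mulrA subnS.
Qed.

Lemma smoothXsubC {R : realType} (z : R) m : smooth (fun x => (x - z) ^+ m).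
Proof.
apply/smoothP => n.
apply: (@times_derivable_eq _ _ (fun x => (1 * x - z) ^+ m)).
  by move=> x; rewrite mul1r.
exact: (times_derivable_affine n (fun x => x ^+ m)) (times_derivableX n m).
Qed.

Lemma derive1nB {R : realType} (F G : R -> R) j : smooth F -> smooth G ->
  derive1n j (fun x => F x - G x) = fun x => derive1n j F x - derive1n j G x.
Proof.
move=> sF sG; elim: j => // j IHj; apply/funext => x.
rewrite derive1nS IHj !derive1nS !derive1E.
apply: (deriveB (f := derive1n j F) (g := derive1n j G)); first exact: sF.
exact: sG.
Qed.

(** * Rolle's theorem for several zeros *)

(** Rolle's theorem is applied in each gap. That the new zeros lie above the first old one lets the
    induction prepend the zero from the preceding gap. *)
Lemma Rolle_path {R : realType} (F : R -> R) (x : R) (s : seq R) :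
  (forall y, derivable F y 1) -> path <%R x s -> F x = 0 ->
  all (fun y => F y == 0) s ->
  exists t, [/\ size t = size s, path <%R x t &
    all (fun y => derive1 F y == 0) t].
Proof.
move=> dF; elim: s x => [|y s IHs] x /=; first by exists [::].
move=> /andP[xy ys] Fx0 /andP[/eqP Fy0 Fs0].
have [t [ts yt t0]] := IHs _ ys Fy0 Fs0.
have cF : {within `[x, y], continuous F}.
  by apply: derivable_within_continuous => ? _; exact: dF.
have [c] := Rolle xy (fun u _ => dF u) cF (etrans Fx0 (esym Fy0)).
rewrite in_itv/= => /andP[xc cy] dFc; exists (c :: t); split => /=.
- by rewrite ts.
- rewrite xc; case: t yt {ts t0} => //= u t /andP[yu ->].
  by rewrite (lt_trans cy yu).
- by rewrite t0 derive1E derive_val eqxx.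
Qed.

(** Each round trades one zero for one derivative, so the [size s] + 1 zeros in [x :: s] leave one
    after [size s] rounds. *)
Lemma Rolle_iter {R : realType} (F : R -> R) (x : R) (s : seq R) :
  smooth F -> path <%R x s -> F x = 0 -> all (fun y => F y == 0) s ->
  exists c, derive1n (size s) F c = 0.
Proof.
move sm : (size s) => m; elim: m F x s sm => [|m IHm] F x s sm sF xs Fx0 Fs0.
  by exists x.
have [t [ts]] := Rolle_path F x s (sF 0%N) xs Fx0 Fs0.
case: t ts => [|y t]; rewrite sm// => -[tm] /= /andP[_ yt] /andP[/eqP Fy0 Ft0].
have [|c Fc0] := IHm (derive1 F) y t tm _ yt Fy0 Ft0.
  by move=> j u; rewrite -derive1Sn; exact: sF.
by exists c; rewrite -derive1nS derive1Sn.
Qed.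

(** F minus (y - z)^m, with m = [size s], has m + 1 zeros, and the m-th derivative of the power is
    the constant m!. *)
Lemma derive1n_eq_fact {R : realType} (F : R -> R) (z x : R) (s : seq R) :
  smooth F -> path <%R x s ->
  all (fun y => F y == (y - z) ^+ size s) (x :: s) ->
  exists c, derive1n (size s) F c = (size s)`!%:R.
Proof.
move=> sF xs /=/andP[Fx Fs]; have sX := smoothXsubC z (size s).
have [||||c] := Rolle_iter (fun y => F y - (y - z) ^+ size s) x s.
- apply/smoothP => n.
  apply: (@times_derivable_eq _ _ (fun y => F y + -1 * (y - z) ^+ size s)).
    by move=> y; rewrite mulN1r.
  apply: times_derivableD; first by move/smoothP : sF; exact.
  apply: times_derivableM; first exact: times_derivable_cst.
  by move/smoothP : sX; exact.
- by [].
- by rewrite (eqP Fx) subrr.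
- by apply: sub_all Fs => y; rewrite subr_eq0.
rewrite derive1nB// derive1nXsubC subnn expr0 mulr1 ffactnn => /eqP.
by rewrite subr_eq0 => /eqP Fc; exists c.
Qed.

(** Turns a cardinality bound into the increasing list that Rolle's theorem needs, by sorting the
    values of an injection. *)
Lemma card_geI_sorted {R : realType} (A : set R) n : (`I_n #<= A)%card ->
  exists s : seq R, [/\ size s = n, sorted <%R s & {in s, forall x, A x}].
Proof.
move=> /pcard_leP/unsquash f.
exists (sort <=%R [seq f i | i <- iota 0 n]); split.
- by rewrite size_sort size_map size_iota.
- rewrite sort_lt_sorted map_inj_in_uniq ?iota_uniq// => i j.
  rewrite !mem_iota !add0n /= => ni nj; by apply: 'inj_f; rewrite inE.
- move=> x; rewrite mem_sort => /mapP[i]; rewrite mem_iota add0n => /= ni ->.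
  exact: (@funS _ _ _ _ f i ni).
Qed.

(** * Basic estimates for the norms *)

Lemma norm_Cn_le {R : realType} (F : R -> R) n (M : R) :
  (forall j x, (j <= n)%N -> `|derive1n j F x| <= M) ->
  (norm_Cn n F <= M%:E)%E.
Proof.
by move=> FM; apply: ge_ereal_sup => _ [j /= jn [x _ <-]]; rewrite lee_fin FM.
Qed.

Lemma le_norm_Cn {R : realType} (F : R -> R) n j x : (j <= n)%N ->
  (`|derive1n j F x|%:E <= norm_Cn n F)%E.
Proof. by move=> jn; apply: ereal_sup_ubound; exists j => //; exists x. Qed.

Lemma quot_norm_ge0 {R : realType} (K : set R) n (f : K -> R) :
  (0 <= quot_norm n f)%E.
Proof.
apply: le_ereal_inf_tmp => _ [F _ <-].
by apply: le_trans (le_norm_Cn F n 0 0 _); rewrite ?lee_fin.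
Qed.

Lemma quot_norm_le {R : realType} (K : set R) (F : R -> R) n (f : K -> R) :
  smooth F -> sigL K F = f -> (quot_norm n f <= norm_Cn n F)%E.
Proof. by move=> sF Ff; apply: ereal_inf_lbound; exists F. Qed.

(** * Monomials cut off at scale r *)

Definition local_monomial {R : realType} (m : nat) (y : R) : R :=
  y ^+ m * smooth_bump y.

Lemma smooth_local_monomial {R : realType} m : smooth (@local_monomial R m).
Proof.
apply/smoothP => n; apply: times_derivableM; first exact: times_derivableX.
exact: times_derivable_bump.
Qed.

(** The prefactor r^m undoes the rescaling of y^m, so that this is (x - z)^m near z; the argument (x
    - z)/r is kept in affine form to suit [derive1n_affine]. *)
Definition scaled_monomial {R : realType} (m : nat) (z r x : R) : R :=
  r ^+ m * local_monomial m (r^-1 * x + - (r^-1 * z)).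

Lemma smooth_scaled_monomial {R : realType} m (z r : R) :
  smooth (scaled_monomial m z r).
Proof.
apply/smoothP => n; apply: times_derivableM; first exact: times_derivable_cst.
apply: times_derivable_affine.
by move/smoothP: (@smooth_local_monomial R m); exact.
Qed.

Lemma scaled_monomial_in {R : realType} m (z r x : R) : 0 < r ->
  `|x - z| <= r / 2 -> scaled_monomial m z r x = (x - z) ^+ m.
Proof.
move=> r0 xz; rewrite /scaled_monomial/local_monomial -mulrBr.
rewrite smooth_bump_le; last first.
  by rewrite normrM normfV (gtr0_norm r0) ler_pdivrMl// mul1r.
by rewrite mulr1 -exprMn mulVKf// gt_eqF.
Qed.

Lemma scaled_monomial_out {R : realType} m (z r x : R) : 0 < r ->
  r <= `|x - z| -> scaled_monomial m z r x = 0.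
Proof.
move=> r0 xz; rewrite /scaled_monomial/local_monomial -mulrBr.
rewrite smooth_bump_ge ?mulr0//.
by rewrite normrM normfV (gtr0_norm r0) ler_pdivlMl// mulr1.
Qed.

(** The j-th derivative is r^(m-j) times that of the fixed function [local_monomial m] at (x - z)/r,
    so M is independent of z and r. For j <= k the power is at most r^-k; for j < m at least one
    factor r remains. *)
Lemma norm_scaled_monomial {R : realType} m k : exists2 M : R, 0 <= M &
  forall z r : R, 0 < r -> r <= 1 ->
    (norm_Cn k (scaled_monomial m z r) <= (M * r ^- k)%:E)%E /\
    forall n, (n < m)%N -> (n <= k)%N ->
    (norm_Cn n (scaled_monomial m z r) <= (M * r)%:E)%E.
Proof.
have sg := @smooth_local_monomial R m.
have [|M M0 HM] := smooth_derive1n_bounded (local_monomial m) 1 k ler01 sg.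
  by move=> x /ltW x1; rewrite /local_monomial smooth_bump_ge ?mulr0.
exists M => // z r r0 r1.
have Hd j x : derive1n j (scaled_monomial m z r) x =
    r ^+ m * r^-1 ^+ j *
    derive1n j (local_monomial m) (r^-1 * x + - (r^-1 * z)).
  by rewrite /scaled_monomial derive1n_affine.
split=> [|n nm nk]; apply: norm_Cn_le => j x jn; rewrite Hd normrM mulrC.
  apply: ler_pM; rewrite ?HM// ger0_norm; last first.
    by rewrite mulr_ge0 ?exprn_ge0 ?invr_ge0// ltW.
  rewrite -[leRHS]mul1r.
  apply: ler_pM; rewrite ?exprn_ge0 ?invr_ge0 ?(ltW r0)//.
    by rewrite exprn_ile1// ltW.
  by rewrite -exprVn ler_weXn2l// invf_ge1.
apply: ler_pM; rewrite ?HM ?(leq_trans jn)// ger0_norm; last first.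
  by rewrite mulr_ge0 ?exprn_ge0 ?invr_ge0// ltW.
rewrite exprVn -expfB ?(leq_ltn_trans jn)//.
case: (m - j)%N (subn_gt0 j m) => [|i _]; first by rewrite (leq_ltn_trans jn).
by rewrite exprS ger_pMr// exprn_ile1// ltW.
Qed.

(** * Lower bound for the quotient norm *)

(** Every extension G of f agrees with F on K, hence with (y - z)^n at n + 1 points, so its n-th
    derivative takes the value n! >= 1. *)
Lemma quot_norm_ge1 {R : realType} (K : set R) n (f : K -> R) (z x : R)
    (s : seq R) (F : R -> R) :
  sigL K F = f -> path <%R x s -> {in x :: s, forall y, K y} -> size s = n ->
  {in x :: s, forall y, F y = (y - z) ^+ n} -> (1%:E <= quot_norm n f)%E.
Proof.
move=> Ff xs sK sn Fs; apply: le_ereal_inf_tmp => _ [G [sG Gf] <-].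
have [|c Gc] := derive1n_eq_fact G z x s sG xs.
  apply/allP => y ys; rewrite sn -Fs//; apply/eqP.
  have /eq_sigLP -> // : sigL K G = sigL K F by rewrite Gf Ff.
  exact/mem_set/sK.
rewrite sn in Gc; apply: le_trans (le_norm_Cn G n n c _) => //.
by rewrite Gc lee_fin normr_nat ler1n fact_gt0.
Qed.

(** * Refutation of a gap in K by the dominating norm *)

Theorem theorem4p1 (R : realType) (K : set R) (hK : compact K)
    (hDN : Cinfty_has_DN K) :
  exists n s : nat, forall e z : R,
    0 < e -> e < 1 / 2 -> K z ->
    (`I_(n + 2) #<= K `&` `]z - e ^+ s, z + e ^+ s[)%card ->
    (K `&` `]z - e, z + e[) `\` `]z - e ^+ s, z + e ^+ s[ !=set0.
Proof.
have [n /(_ n.+1 (leqnSn n)) [k [c [nk c0 DN]]]] := hDN.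
have [M M0 HM] := @norm_scaled_monomial R n.+1 k.
(* M is uniform in z and in the scale, so t can be fixed before e and z are given. *)
have [t ht] : exists t, 2 * c * M ^+ 2 < 2 ^+ t.
  have C0 : 0 <= 2 * c * M ^+ 2 by rewrite !mulr_ge0 ?sqr_ge0// ltW.
  exists (Num.bound (2 * c * M ^+ 2)); apply: (lt_le_trans (archi_boundP C0)).
  by rewrite -natrX ler_nat ltnW// ltn_expl.
(* In s = k + t + 2, the k cancels e^-k, the t makes e^t beat the constant 2 c M^2, and the 2 gives
   2 d <= e. *)
exists n, (k + t.+2)%N => e z e0 e2 Kz; set d := e ^+ (k + t.+2) => cardK.
apply/set0P/negP => /eqP gap.
have e1 : e <= 1 by lra.
have d0 : 0 < d by rewrite exprn_gt0.
have de : 2 * d <= e.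
  apply: (@le_trans _ _ (2 * e ^+ 2)).
    by rewrite ler_wpM2l// ler_wiXn2l ?(ltW e0)// !addnS !ltnS leq0n.
  by rewrite expr2 mulrA ger_pMl//; lra.
have d20 : 0 < 2 * d by rewrite mulr_gt0.
have sE := @smooth_scaled_monomial R n.+1 z.
pose f := sigL K (scaled_monomial n.+1 z e).
(* Both cutoffs restrict to the same f: for |x - z| < d both equal (x - z)^(n+1), since d <= e/2;
   otherwise the gap gives |x - z| >= e >= 2 d and both vanish. *)
have fd : sigL K (scaled_monomial n.+1 z (2 * d)) = f.
  apply/eq_sigLP => x /set_mem Kx; have [xd|dx] := ltP `|x - z| d.
    by rewrite !scaled_monomial_in//; lra.
  have ex : e <= `|x - z|.
    rewrite leNgt; apply/negP => xe.
    suff : (set0 : set R) x by [].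
    rewrite -gap; split; first split=> //.
      by rewrite /= in_itv/= -ltr_distl.
    by rewrite /= in_itv/= -ltr_distl; apply/negP; rewrite -leNgt.
  by rewrite !scaled_monomial_out// (le_trans de).
have fK : f \in smooth_on K by apply/mem_set; exists (scaled_monomial n.+1 z e).
(* The n + 2 points split into a head and n + 1 further ones, the count required for a derivative of
   order n + 1. *)
have [[|x s] [/= ssz xs sK]] := card_geI_sorted _ _ cardK.
  by move: ssz; rewrite addn2.
have pm : (1%:E <= quot_norm n.+1 f)%E.
  apply: (@quot_norm_ge1 _ _ _ _ z x s (scaled_monomial n.+1 z e)) => //.
  - by move=> y /sK[].
  - by move: ssz; rewrite addn2 => -[].
  - move=> y /sK[_] /=; rewrite in_itv/= -ltr_distl => yd.
    by rewrite scaled_monomial_in//; lra.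
have pk : (quot_norm k f <= (M * e ^- k)%:E)%E.
  by apply: le_trans (HM z e e0 e1).1; exact: quot_norm_le.
have pn : (quot_norm n f <= (M * (2 * d))%:E)%E.
  (* The extension at the small scale serves here: orders up to n < n + 1 leave a factor 2 d. *)
  apply: le_trans ((HM z (2 * d) d20 (le_trans de e1)).2 n _ _) => //.
    exact: quot_norm_le.
  exact: ltnW.
have /= dn := DN (SigSub fK).
have p1 : (1%:E <= quot_norm n.+1 f * quot_norm n.+1 f)%E.
  by rewrite -[leLHS]mule1; exact: lee_pmul.
have : (1%:E <= c%:E * (M * e ^- k)%:E * (M * (2 * d))%:E)%E.
  apply: le_trans p1 _; apply: le_trans dn _.
  apply: lee_pmul => //; rewrite ?mule_ge0 ?quot_norm_ge0 ?lee_fin ?(ltW c0)//.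
  apply: lee_wpmul2l; rewrite ?lee_fin ?(ltW c0)//.
rewrite -!EFinM lee_fin leNgt => /negP; apply.
have -> : c * (M * e ^- k) * (M * (2 * d)) = 2 * c * M ^+ 2 * e ^+ t.+2.
  by rewrite /d exprD; field; rewrite expf_neq0// gt_eqF.
(* Here e < 1/2 enters: e^(t+2) <= e^t <= 2^-t. *)
apply: (@le_lt_trans _ _ (2 * c * M ^+ 2 * 2 ^- t)).
  apply: ler_wpM2l; first by rewrite !mulr_ge0 ?sqr_ge0// ltW.
  apply: (@le_trans _ _ (e ^+ t)).
    by rewrite ler_wiXn2l ?(ltW e0)// !leqW.
  by rewrite -exprVn lerXn2r ?nnegrE ?(ltW e0)//; lra.
by rewrite ltr_pdivrMr ?exprn_gt0// mul1r.
Qed.
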